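(* Let $f:\mathbb{R}^d\to\mathbb{R}^d$ be an order-preserving map that is nonexpansive with respect to the sup-norm, and let $u$ be a fixed point of $f$. Then $u$ is a locally minimal fixed point of $f$ if and only if $u$ is the smallest fixed point of $f$. If in addition $f$ is piecewise affine, then the following assertions are equivalent: 1. $u$ is the smallest fixed point of $f$ (in $\mathbb{R}^d$); 2. $\{h\in\mathbb{R}^d_-\mid f'_u(h)=h\}=\{0\}$; 3. $\rho_{\mathbb{R}^d_-}(f'_u)<1$.
   Context: $\mathbb{R}^d$ carries the sup-norm $\|\cdot\|$ and the coordinatewise partial order $\leqslant$; $\mathbb{R}^d_-=\{h\in\mathbb{R}^d\mid h\leqslant 0\}$. A map $f$ is order-preserving if $x\leqslant y$ implies $f(x)\leqslant f(y)$, and nonexpansive if $\|f(x)-f(y)\|\leqslant\|x-y\|$ for all $x,y\in\mathbb{R}^d$. The smallest fixed point of $f$ is a fixed point $u\in\mathbb{R}^d$ with $u\leqslant v$ for every fixed point $v\in\mathbb{R}^d$ of $f$. A fixed point $u$ of $f$ is locally minimal if there is a neighborhood $\mathcal V$ of $u$ such that for every fixed point $v\in\mathcal V$ of $f$, $v\leqslant u$ implies $v=u$. $f$ is piecewise affine if for every $j\in\{1,\dots,d\}$ there are finite nonempty sets $A_j$ and $B_a$ ($a\in A_j$) and affine maps $g_{a,b}:\mathbb{R}^d\to\mathbb{R}$ such that $f_j=\min_{a\in A_j}\max_{b\in B_a}g_{a,b}$. A map $g$ is homogeneous if $g(\lambda x)=\lambda g(x)$ for all real $\lambda>0$. $f$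 is semidifferentiable at $u$ if there is a continuous homogeneous map $g:\mathbb{R}^d\to\mathbb{R}^d$ with $f(u+h)=f(u)+g(h)+o(\|h\|)$ for $h$ in a neighborhood of $0$; such $g$ is unique, is called the semidifferential of $f$ at $u$ and is denoted $f'_u$. Piecewise affine maps are semidifferentiable at every point. For a continuous homogeneous self-map $g$ of the cone $\mathbb{R}^d_-$, the spectral radius is $\rho_{\mathbb{R}^d_-}(g)=\sup\{\lambda\geqslant 0\mid\exists x\in\mathbb{R}^d_-\setminus\{0\},\ g(x)=\lambda x\}$; here it is applied to the restriction of $f'_u$ to $\mathbb{R}^d_-$ (which maps $\mathbb{R}^d_-$ to itself since $f$ is order-preserving). *)

(* Defs.v *)
From HB Require Import structures.
From mathcomp Require Import all_boot all_order all_algebra.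
From mathcomp Require Import all_classical all_reals all_analysis.

Set Implicit Arguments.
Unset Strict Implicit.
Unset Printing Implicit Defensive.

Import Order.TTheory GRing.Theory Num.Theory.
Import numFieldNormedType.Exports.

Local Open Scope classical_set_scope.
Local Open Scope ring_scope.

(* Vectors of R^d are rows 'rV[R]_d; the library norm `|x| on 'rV[R]_d is the
   sup-norm. *)

Definition le_vec (R : realType) (d : nat) (x y : 'rV[R]_d) : Prop :=
  forall i, x 0 i <= y 0 i.

Definition nonpos_cone (R : realType) (d : nat) : set 'rV[R]_d :=
  [set h | le_vec h 0].

Definition order_preserving (R : realType) (d : nat)
    (f : 'rV[R]_d -> 'rV[R]_d) : Prop :=
  forall x y, le_vec x y -> le_vec (f x) (f y).

Definition nonexpansive (R : realType) (d : nat)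
    (f : 'rV[R]_d -> 'rV[R]_d) : Prop :=
  forall x y, `|f x - f y| <= `|x - y|.

Definition is_smallest_fixpoint (R : realType) (d : nat)
    (f : 'rV[R]_d -> 'rV[R]_d) (u : 'rV[R]_d) : Prop :=
  f u = u /\ forall v, f v = v -> le_vec u v.

Definition is_locally_minimal_fixpoint (R : realType) (d : nat)
    (f : 'rV[R]_d -> 'rV[R]_d) (u : 'rV[R]_d) : Prop :=
  f u = u /\
  exists2 V, nbhs u V & forall v, V v -> f v = v -> le_vec v u -> v = u.

Definition is_affine (R : realType) (d : nat) (g : 'rV[R]_d -> R) : Prop :=
  exists (c : 'cV[R]_d) (b : R), forall x, g x = (x *m c) 0 0 + b.

(* The witnesses a0 and b0 record that the index sets are nonempty.  They also
   provide the default values of the iterated min and max; these values already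
   belong to the families, so they do not alter the extrema. *)
Definition piecewise_affine (R : realType) (d : nat)
    (f : 'rV[R]_d -> 'rV[R]_d) : Prop :=
  forall j : 'I_d,
  exists (A : finType) (B : A -> finType) (a0 : A) (b0 : forall a, B a)
    (g : forall a, B a -> 'rV[R]_d -> R),
    (forall a b, is_affine (g a b)) /\
    forall x,
      let maxB a := \big[Num.max/g a (b0 a) x]_(b : B a) g a b x in
      f x 0 j = \big[Num.min/maxB a0]_(a : A) maxB a.

Definition homogeneous (R : realType) (d : nat)
    (g : 'rV[R]_d -> 'rV[R]_d) : Prop :=
  forall (l : R) x, 0 < l -> g (l *: x) = l *: g x.

Definition is_semidifferential (R : realType) (d : nat)
    (f : 'rV[R]_d -> 'rV[R]_d) (u : 'rV[R]_d) (g : 'rV[R]_d -> 'rV[R]_d) :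
    Prop :=
  [/\ continuous g, homogeneous g &
      (fun h : 'rV[R]_d => f (u + h) - (f u + g h)) =o_ (0 : 'rV[R]_d) id].

(* The semidifferential f'_u; it is the zero map, a junk value, when f is not
   semidifferentiable at u. *)
Definition semidiff (R : realType) (d : nat)
    (f : 'rV[R]_d -> 'rV[R]_d) (u : 'rV[R]_d) : 'rV[R]_d -> 'rV[R]_d :=
  xget (fun=> 0) [set g | is_semidifferential f u g].

(* Only the values of g on C matter.  The supremum is taken in \bar R, so no
   boundedness assumption is hidden; it is -oo when there is no eigenvalue. *)
Definition cone_spectral_radius (R : realType) (d : nat) (C : set 'rV[R]_d)
    (g : 'rV[R]_d -> 'rV[R]_d) : \bar R :=
  ereal_sup [set l%:E | l in
    [set l : R | 0 <= l /\ exists x, [/\ C x, x != 0 & g x = l *: x]]].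

(* Main.v *)
(* A fixed point [u] which is not the smallest one is not locally minimal
   either: if [w] is fixed and [m > 0] is the largest coordinate of [u - w], then
   for every small [s > 0] the map [f] preserves the order interval from [u - s]
   to [min u (w + (m - s))], as nonexpansiveness makes [w + r] a super-solution
   and [u - s] a sub-solution.  This interval does not contain [u], lies within
   distance [s] of [u], and contains a fixed point by Knaster-Tarski.

   When [f] is piecewise affine, [f (u + h) = u + f'_u h] exactly for small [h],
   so by homogeneity the fixed points of [f] below and near [u] are governed by
   the fixed points of [f'_u] in the nonpositive cone.  The semidifferential
   inherits [`|f'_u h| <= `|h|], hence its eigenvalues are at most [1]; by
   compactness they stay away from [1] if [1] is not an eigenvalue. *)

Require Import Defs.
From HB Require Import structures.
From mathcomp Require Import all_boot all_order all_algebra.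
From mathcomp Require Import all_classical all_reals all_analysis.
From mathcomp Require Import ring lra.

Set Implicit Arguments.
Unset Strict Implicit.
Unset Printing Implicit Defensive.

Import Order.TTheory GRing.Theory Num.Theory.
Import numFieldNormedType.Exports.
Local Open Scope classical_set_scope.
Local Open Scope ring_scope.

(** * The sup-norm and the order in coordinates *)

Lemma rV_norm_leP (R : realType) (d : nat) (x : 'rV[R]_d) (e : R) :
  0 <= e -> `|x| <= e <-> forall i, `|x 0 i| <= e.
Proof.
move=> e0; rewrite /Num.Def.normr /= mx_normrE; split.
  by move=> /bigmax_leP[_ H] i; exact: (H (0, i)).
by move=> H; apply/bigmax_leP; split=> // -[i j] _; rewrite (ord1 i); exact: H.
Qed.

Lemma coord_le_norm (R : realType) (d : nat) (x : 'rV[R]_d) i :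
  `|x 0 i| <= `|x|.
Proof. exact: (rV_norm_leP x (normr_ge0 x)).1. Qed.

Lemma le_vec_trans (R : realType) (d : nat) (y x z : 'rV[R]_d) :
  le_vec x y -> le_vec y z -> le_vec x z.
Proof. by move=> xy yz i; exact: le_trans (xy i) (yz i). Qed.

Lemma le_vec_anti (R : realType) (d : nat) (x y : 'rV[R]_d) :
  le_vec x y -> le_vec y x -> x = y.
Proof. by move=> xy yx; apply/rowP => i; apply/le_anti; rewrite xy yx. Qed.

(** * Fixed points in order intervals and local minimality *)

(** The coordinatewise supremum [y] of the sub-solutions in the interval is itself a sub-solution;
    then so is [f y], whence [f y <= y]. *)
Lemma knaster_tarski (R : realType) (d : nat) (f : 'rV[R]_d -> 'rV[R]_d)
    (x b : 'rV[R]_d) :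
  order_preserving f -> le_vec x b -> le_vec x (f x) -> le_vec (f b) b ->
  exists y, [/\ f y = y, le_vec x y & le_vec y b].
Proof.
move=> f_op xb xfx fbb.
pose S := [set v | [/\ le_vec x v, le_vec v b & le_vec v (f v)]].
have Sx : S x by split=> // i.
pose y : 'rV[R]_d := \row_i sup [set v 0 i | v in S].
have S_le v : S v -> le_vec v y.
  move=> Sv i; rewrite mxE; apply: ub_le_sup; last by exists v.
  by exists (b 0 i) => _ [w [_ wb _] <-].
have y_le z : (forall v, S v -> le_vec v z) -> le_vec y z.
  move=> ubz i; rewrite mxE; apply: ge_sup; first by exists (x 0 i), x.
  by move=> _ [v Sv <-]; exact: ubz.
have yb : le_vec y b by apply: y_le => v [].
have yfy : le_vec y (f y).
  apply: y_le => v Sv; apply: (@le_vec_trans _ _ (f v)); first by case: Sv.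
  by apply/f_op/S_le.
exists y; split=> //; last exact: S_le.
apply: le_vec_anti => //; apply: (S_le); split; last exact: f_op.
  exact: le_vec_trans (S_le _ Sx) yfy.
exact: le_vec_trans (f_op _ _ yb) fbb.
Qed.

(** Shifting [w] by [r] moves its image by at most [r] in each coordinate. *)
Lemma fixpoint_shift_le (R : realType) (d : nat) (f : 'rV[R]_d -> 'rV[R]_d)
    (w : 'rV[R]_d) (r : R) :
  nonexpansive f -> f w = w -> 0 <= r ->
  le_vec (f (w + const_mx r)) (w + const_mx r) /\
  le_vec (w - const_mx r) (f (w - const_mx r)).
Proof.
move=> f_ne fw r0.
have cr : `|const_mx r : 'rV[R]_d| <= r.
  by apply/rV_norm_leP => // i; rewrite mxE ger0_norm.
have [H1 H2] : `|f (w + const_mx r) - w| <= r /\ `|f (w - const_mx r) - w| <= r.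
  split; rewrite -{2}fw; apply: (le_trans (f_ne _ _)).
    by rewrite addrC addKr.
  by rewrite addrC addKr normrN.
split=> i.
  have := le_trans (coord_le_norm _ i) H1.
  by rewrite !mxE ler_norml => /andP[_]; lra.
have := le_trans (coord_le_norm _ i) H2.
by rewrite !mxE ler_norml => /andP[]; lra.
Qed.

Lemma locally_minimal_fixpointP (R : realType) (d : nat)
    (f : 'rV[R]_d -> 'rV[R]_d) (u : 'rV[R]_d) :
  order_preserving f -> nonexpansive f -> f u = u ->
  is_locally_minimal_fixpoint f u <-> is_smallest_fixpoint f u.
Proof.
move=> f_op f_ne fu; split; last first.
  move=> [_ umin]; split=> //; exists setT; first exact: filterT.
  by move=> v _ fv vu; apply: le_vec_anti => //; exact: umin.
move=> [_ [V nV Vmin]]; split=> // w fw i; rewrite leNgt; apply/negP => wui.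
have [k _ kmax] := @arg_maxP _ _ _ i xpredT (fun j => u 0 j - w 0 j) isT.
set m := u 0 k - w 0 k in kmax.
have m0 : 0 < m by apply: (lt_le_trans _ (kmax i isT)); rewrite subr_gt0.
have [e /= e0 eV] := (nbhs_normP u V).1 nV.
(* [s <= m] makes the upward shift [m - s] of [w] nonnegative; [s < e] keeps the interval inside
   [V]. *)
pose s := Num.min m (e / 2).
have s0 : 0 < s by rewrite lt_min m0 divr_gt0.
have se : s < e.
  by rewrite gt_min; apply/orP; right; rewrite ltr_pdivrMr // ltr_pMr // ltr1n.
have sm : s <= m by rewrite ge_min lexx.
have [lb _] := (fixpoint_shift_le f_ne fu (ltW s0)).
have [_ us] := (fixpoint_shift_le f_ne fu (ltW s0)).
have ms0 : 0 <= m - s by rewrite subr_ge0.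
have [ws _] := (fixpoint_shift_le f_ne fw ms0).
pose b : 'rV[R]_d := \row_j Num.min (u 0 j) (w 0 j + (m - s)).
have bu : le_vec b u by move=> j; rewrite mxE ge_min lexx.
have bw : le_vec b (w + const_mx (m - s)).
  by move=> j; rewrite !mxE ge_min lexx orbT.
have fbb : le_vec (f b) b.
  move=> j; rewrite [leRHS]mxE le_min; apply/andP; split.
    by have := f_op _ _ bu j; rewrite fu.
  by have := le_vec_trans (f_op _ _ bw) ws j; rewrite !mxE.
have usb : le_vec (u - const_mx s) b.
  move=> j; rewrite !mxE le_min; have := kmax j isT => /= kj.
  by apply/andP; split; lra.
have [y [fy usy yb]] := knaster_tarski f_op usb us fbb.
have yu : y = u.
  apply: Vmin => //; last exact: le_vec_trans yb bu.
  apply: eV; apply: le_lt_trans se; apply/rV_norm_leP; first exact: ltW.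
  move=> j; have := usy j; have := le_vec_trans yb bu j.
  by rewrite !mxE ler_norml => ? ?; apply/andP; split; lra.
(* At the maximizing coordinate [w 0 k + (m - s)] equals [u 0 k - s], so [b], and hence [y], is
   strictly below [u] there. *)
have := yb k; rewrite yu mxE le_min => /andP[_]; rewrite /m; lra.
Qed.

(** * Exact local expansion of piecewise affine maps *)

(** Used to carry local facts to arbitrary vectors: homogeneity then removes the factor [t]. *)
Lemma near0_scale (R : realType) (V : normedModType R) (P : set V) (h : V) :
  (\forall k \near (0 : V), P k) -> exists2 t : R, 0 < t & P (t *: h).
Proof.
move=> P0; have th : (fun t : R => t *: h) x @[x --> 0^'+] --> (0 : V).
  rewrite -[X in _ --> X](scale0r h); apply: cvg_at_right_filter.
  exact: scalel_continuous.
near (0 : R)^'+ => t; exists t; first by near: t; exact: nbhs_right_gt.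
by near: t; exact: th.
Unshelve. all: by end_near. Qed.

(** A scalar semidifferential with no error term near [u]; unlike affinity, this property is stable
    under min and max. *)
Definition conical_near (R : realType) (d : nat) (F : 'rV[R]_d -> R)
    (u : 'rV[R]_d) : Prop :=
  exists G : 'rV[R]_d -> R,
  [/\ continuous G, forall l x, 0 < l -> G (l *: x) = l * G x &
      \forall h \near (0 : 'rV[R]_d), F (u + h) = F u + G h].

Lemma homogeneous_scalar0 (R : realType) (V : lmodType R) (G : V -> R) :
  (forall l x, 0 < l -> G (l *: x) = l * G x) -> G 0 = 0.
Proof. by move=> Gh; have := Gh 2 0 (ltr0n _ 2); rewrite scaler0; lra. Qed.

Lemma affine_conical_near (R : realType) (d : nat) (F : 'rV[R]_d -> R)
    (u : 'rV[R]_d) : is_affine F -> conical_near F u.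
Proof.
move=> [c [b FE]]; exists (fun h => (h *m c) 0 0); split.
- have hc i : continuous (fun h : 'rV[R]_d => h 0 i * c i 0).
    by move=> x; apply: continuousM;
      [exact: coord_continuous|exact: cst_continuous].
  under eq_fun do rewrite mxE.
  by apply: continuous_big => //; exact: add_continuous.
- by move=> l x _; rewrite -scalemxAl mxE.
- by near=> h; rewrite !FE mulmxDl mxE; ring.
Unshelve. all: by end_near. Qed.

Lemma conical_nearN (R : realType) (d : nat) (F : 'rV[R]_d -> R)
    (u : 'rV[R]_d) : conical_near F u -> conical_near (fun x => - F x) u.
Proof.
move=> [G [Gc Gh FG]]; exists (fun h => - G h); split.
- by move=> x; apply: continuousN; exact: Gc.
- by move=> l x l0; rewrite Gh // mulrN.
- by near=> h; rewrite -opprD; congr (- _); near: h.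
Unshelve. all: by end_near. Qed.

(** If the values at [u] tie, the increment is the max of the two increments; otherwise the larger
    function dominates near [u] and its increment alone remains. *)
Lemma conical_near_max (R : realType) (d : nat) (F1 F2 : 'rV[R]_d -> R)
    (u : 'rV[R]_d) : conical_near F1 u -> conical_near F2 u ->
  conical_near (fun x => Num.max (F1 x) (F2 x)) u.
Proof.
wlog le12 : F1 F2 / F1 u <= F2 u => [wl|] c1 c2.
  have [le12|/ltW le21] := leP (F1 u) (F2 u); first exact: wl.
  rewrite (_ : (fun x => _) = fun x => Num.max (F2 x) (F1 x)); first exact: wl.
  by apply/funext => x; rewrite maxC.
move: c1 c2 le12 => [G1 [G1c G1h FG1]] [G2 [G2c G2h FG2]].
rewrite le_eqVlt => /predU1P[eq12|lt12].
  exists (fun h => Num.max (G1 h) (G2 h)); split.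
  - by move=> x; apply: (@continuous_max R _ G1 G2); [exact: G1c|exact: G2c].
  - by move=> l x l0; rewrite G1h // G2h // maxr_pMr // ltW.
  - near=> h; rewrite eq12 maxxx -eq12 addr_maxr; congr Num.max; near: h => //.
    by rewrite eq12.
exists G2; split=> //; near=> h.
have -> : F2 (u + h) = F2 u + G2 h by near: h.
have -> : F1 (u + h) = F1 u + G1 h by near: h.
rewrite (max_idPr (ltW lt12)); apply/max_idPr/ltW.
rewrite -subr_gt0; near: h.
(* Both increments vanish at [0], so the gap tends to [F2 u - F1 u > 0]. *)
have Gc : {for 0, continuous (fun h => F2 u + G2 h - (F1 u + G1 h))}.
  by apply: continuousB; apply: continuousD;
    [exact: cst_continuous|exact: G2c|exact: cst_continuous|exact: G1c].
apply: (cvgr_gt _ Gc); rewrite (homogeneous_scalar0 G1h) (homogeneous_scalar0 G2h) !addr0 subr_gt0.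
Unshelve. all: by end_near. Qed.

Lemma conical_near_bigmax (R : realType) (d : nat) (I : finType)
    (F0 : 'rV[R]_d -> R) (F : I -> 'rV[R]_d -> R) (u : 'rV[R]_d) :
  conical_near F0 u -> (forall i, conical_near (F i) u) ->
  conical_near (fun x => \big[Num.max/F0 x]_i F i x) u.
Proof.
move=> c0 cF; elim: (index_enum I) => [|i s IH].
  by under eq_fun do rewrite big_nil.
under eq_fun do rewrite big_cons; exact: conical_near_max.
Qed.

Lemma conical_near_bigmin (R : realType) (d : nat) (I : finType)
    (F0 : 'rV[R]_d -> R) (F : I -> 'rV[R]_d -> R) (u : 'rV[R]_d) :
  conical_near F0 u -> (forall i, conical_near (F i) u) ->
  conical_near (fun x => \big[Num.min/F0 x]_i F i x) u.
Proof.
move=> c0 cF.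
have -> : (fun x => \big[Num.min/F0 x]_i F i x) =
    fun x => - (\big[Num.max/- F0 x]_i - F i x).
  apply/funext => x; elim/big_rec2 : _ => [|i a b _ ->]; first by rewrite opprK.
  by rewrite oppr_max opprK.
apply: conical_nearN; apply: conical_near_bigmax => [|i]; exact: conical_nearN.
Qed.

Lemma rV_continuous (R : realType) (T : topologicalType) (d : nat)
    (G : T -> 'rV[R]_d) :
  (forall i, continuous (fun x => G x 0 i)) -> continuous G.
Proof.
move=> Gc x; apply/cvgrPdist_le => e e0.
have : \forall y \near x, forall i, `|G x 0 i - G y 0 i| <= e.
  by apply: filter_forall => i; move/cvgrPdist_le : (Gc i x); exact.
apply: filterS => y Gy; apply/rV_norm_leP => [|i]; first exact: ltW.
by rewrite !mxE; exact: Gy.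
Qed.

Lemma piecewise_affine_expansion (R : realType) (d : nat)
    (f : 'rV[R]_d -> 'rV[R]_d) (u : 'rV[R]_d) : piecewise_affine f ->
  exists g : 'rV[R]_d -> 'rV[R]_d, [/\ continuous g, homogeneous g &
    \forall h \near (0 : 'rV[R]_d), f (u + h) = f u + g h].
Proof.
move=> f_pa; have /choice[G GP] (j : 'I_d) : conical_near (fun x => f x 0 j) u.
  have [A [B [a0 [b0 [g [g_aff fE]]]]]] := f_pa j.
  rewrite (funext fE) /=; apply: conical_near_bigmin => [|a];
    apply: conical_near_bigmax => [|b]; exact: affine_conical_near.
exists (fun h => \row_j G j h); split.
- apply: rV_continuous => j; under eq_fun do rewrite mxE.
  by case: (GP j).
- by move=> l x l0; apply/rowP => j; rewrite !mxE; case: (GP j) => _ ->.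
- have nG j : \forall h \near (0 : 'rV[R]_d), f (u + h) 0 j = f u 0 j + G j h.
    by case: (GP j).
  have := filter_forall (nbhs_filter _) nG.
  by apply: filterS => h fh; apply/rowP => j; rewrite !mxE fh.
Qed.

(** * The semidifferential and its fixed points *)

(** Since [g] is a semidifferential, the choice in [semidiff] is not the junk value; two homogeneous
    maps that differ by [o(h)] coincide, by scaling. *)
Lemma semidiff_expansion (R : realType) (d : nat) (f g : 'rV[R]_d -> 'rV[R]_d)
    (u : 'rV[R]_d) : continuous g -> homogeneous g ->
  (\forall h \near (0 : 'rV[R]_d), f (u + h) = f u + g h) -> semidiff f u = g.
Proof.
move=> gc gh fg.
have [_ g'h] : is_semidifferential f u (semidiff f u).
  apply: (xgetPex (fun=> 0) (P := [set g | is_semidifferential f u g])).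
  exists g; split=> //; apply/eqoP => e e0.
  by near=> h; rewrite (near fg h) // subrr normr0 mulr_ge0 // ltW.
move=> /eqoP g'o; apply/funext => h; apply/subr0_eq/eqP.
rewrite -normr_le0; apply/ler_addgt0Pl => e e0; rewrite addr0.
(* The tolerance [e / (|h| + 1)] yields an error at most [e] after division by [t]; the [+ 1] covers
   [h = 0]. *)
have h1 : 0 < `|h| + 1 by rewrite ltr_wpDl.
have [t t0 [fth]] := near0_scale h (filterI fg (g'o _ (divr_gt0 e0 h1))).
rewrite fth g'h // gh // opprD addrACA subrr add0r -scalerBr /= !normrZ.
rewrite mulrCA ler_pM2l ?gtr0_norm // distrC => /le_trans; apply.
by rewrite mulrAC ler_pdivrMr // ler_pM2l // lerDl.
Unshelve. all: by end_near. Qed.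

Lemma expansion_norm_le (R : realType) (d : nat) (f g : 'rV[R]_d -> 'rV[R]_d)
    (u : 'rV[R]_d) : nonexpansive f -> homogeneous g ->
  (\forall h \near (0 : 'rV[R]_d), f (u + h) = f u + g h) ->
  forall h, `|g h| <= `|h|.
Proof.
move=> f_ne gh fg h; have [t t0 fth] := near0_scale h fg.
have := f_ne (u + t *: h) u; rewrite fth gh // addrC addKr addrC addKr !normrZ.
by rewrite ler_pM2l // gtr0_norm.
Qed.

Lemma smallest_fixpoint_expansionP (R : realType) (d : nat)
    (f g : 'rV[R]_d -> 'rV[R]_d) (u : 'rV[R]_d) :
  order_preserving f -> nonexpansive f -> f u = u -> homogeneous g ->
  (\forall h \near (0 : 'rV[R]_d), f (u + h) = f u + g h) ->
  is_smallest_fixpoint f u <-> [set h | nonpos_cone h /\ g h = h] = [set 0].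
Proof.
move=> f_op f_ne fu gh fg; rewrite -locally_minimal_fixpointP //; split.
  move=> [_ [V nV Vmin]]; apply/seteqP; split=> [h [h0 ghh]|_ ->] /=; last first.
    split=> //; apply/eqP; rewrite -normr_le0 -(@normr0 _ 'rV[R]_d).
    exact: expansion_norm_le f_ne gh fg 0.
  have nV0 : \forall h \near (0 : 'rV[R]_d), V (u + h) by apply: (nbhs0P V u).1.
  (* A fixed point [h] of [g] in the cone yields the fixed point [u + t *: h] of [f], below [u] and
     in [V]. *)
  have [t t0 [fth Vth]] := near0_scale h (filterI fg nV0).
  have uth : u + t *: h = u.
    apply: Vmin => //; first by rewrite fth fu gh // ghh.
    by move=> i; rewrite !mxE gerDl pmulr_rle0 //; have := h0 i; rewrite mxE.
  apply/eqP; have /eqP := uth; rewrite -subr_eq0 addrC addKr scaler_eq0.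
  by rewrite gt_eqF.
(* Where the expansion is exact, a fixed point [v <= u] of [f] makes [v - u] a fixed point of [g] in
   the cone. *)
move=> fix0; split=> //; exists [set v | f (u + (v - u)) = f u + g (v - u)].
  apply/(@nbhs0P _ 'rV[R]_d); apply: filterS fg => h fh /=.
  by rewrite (addrAC u) subrr add0r.
move=> v /=; rewrite addrC subrK => fv fvv vu; apply/subr0_eq.
have : [set h | nonpos_cone h /\ g h = h] (v - u).
  split; first by move=> i; rewrite !mxE subr_le0.
  by apply/(addrI u); rewrite -{1}fu -fv fvv addrC subrK.
by rewrite fix0.
Qed.

(** * Eigenvalues on the nonpositive cone *)

Lemma fixpoint_cone_spectral_radiusP (R : realType) (d : nat)
    (g : 'rV[R]_d -> 'rV[R]_d) :
  continuous g -> homogeneous g -> (forall h, `|g h| <= `|h|) ->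
  [set h | nonpos_cone h /\ g h = h] = [set 0] <->
  (cone_spectral_radius (@nonpos_cone R d) g < 1%:E)%E.
Proof.
move=> gc gh gle; split; last first.
  move=> lt1; apply/seteqP; split=> [h [h0 ghh]|_ ->] /=; last first.
    by split=> //; apply/eqP; rewrite -normr_le0 -(@normr0 _ 'rV[R]_d).
  apply: contraPP lt1 => /eqP hn0; apply/negP; rewrite -leNgt.
  by apply: ereal_sup_ubound; exists 1 => //; split=> //; exists h;
    rewrite scale1r.
move=> fix0.
(* Every eigenvalue is at most [1 - `|g c - c|], where [c] minimizes
   [`|g x - x|] on the unit sphere of the cone. *)
pose S := [set x : 'rV[R]_d | nonpos_cone x /\ `|x| = 1].
have normS x : nonpos_cone x -> x != 0 -> S (`|x|^-1 *: x).
  move=> x0 xn0; split; last by rewrite normrZ ger0_norm // mulVf // normr_eq0.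
  by move=> i; have := x0 i; rewrite !mxE => xi; rewrite mulr_ge0_le0.
(* The sphere is empty when [d = 0]: there is no eigenvalue and the supremum is [-oo]. *)
have [S0|/set0P S0] := eqVneq S set0.
  apply: (@le_lt_trans _ _ -oo%E); last exact: ltNyr.
  apply: ge_ereal_sup => _ [l [_ [x [x0 xn0 _]]] <-].
  by have := normS x x0 xn0; rewrite S0.
have Sc : compact S.
  apply: bounded_closed_compact.
    by exists 1; split=> // M M1 x [_ x1]; rewrite /= x1; exact: ltW.
  apply: closedI.
    rewrite (_ : @nonpos_cone R d = \bigcap_(i in setT) [set x | x 0 i <= 0]).
      apply: closed_bigI => i _; apply: preimage_closed (@closed_le R 0) => x _.
      exact: coord_continuous.
    apply/seteqP; split=> x /= H i; first by have := H i; rewrite mxE.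
    by rewrite mxE; exact: H.
  apply: preimage_closed (@closed_eq R 1) => x _; exact: norm_continuous.
have [|c /set_mem[c0 c1] cmin] := @EVT_min_rV R d (fun x => `|g x - x|) S S0 Sc.
  apply: continuous_subspaceT => x.
  have gBc : {for x, continuous (fun y => g y - y)}.
    by apply: continuousB; [exact: gc|exact: cvg_id].
  exact: continuous_comp gBc (@norm_continuous _ _ _).
have m0 : 0 < `|g c - c|.
  rewrite normr_gt0 subr_eq0; apply/negP => /eqP gcc.
  have : [set h | nonpos_cone h /\ g h = h] c by split.
  by rewrite fix0 /= => c00; have := c1; rewrite c00 normr0; lra.
apply: (@le_lt_trans _ _ (1 - `|g c - c|)%:E); last by rewrite lte_fin; lra.
apply: ge_ereal_sup => _ [l [l0 [x [x0 xn0 gx]]] <-]; rewrite lee_fin.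
have xg0 : 0 < `|x| by rewrite normr_gt0.
have l1 : l <= 1.
  by have := gle x; rewrite gx normrZ ger0_norm // ger_pMl.
(* At the normalized eigenvector the minimized quantity is [|l - 1| = 1 - l]. *)
have := cmin _ (mem_set (normS _ x0 xn0)).
rewrite gh ?invr_gt0 // gx -scalerBr -[X in l *: x - X]scale1r -scalerBl !normrZ.
rewrite normfV normr_id mulrCA mulVf ?gt_eqF // mulr1 ler0_norm; lra.
Qed.

Theorem theorem3p2 (R : realType) (d : nat) (f : 'rV[R]_d -> 'rV[R]_d)
    (u : 'rV[R]_d) (f_op : order_preserving f) (f_ne : nonexpansive f)
    (fu : f u = u) :
  (is_locally_minimal_fixpoint f u <-> is_smallest_fixpoint f u) /\
  (piecewise_affine f ->
    (is_smallest_fixpoint f u <->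
      [set h | nonpos_cone h /\ semidiff f u h = h] = [set 0]) /\
    ([set h | nonpos_cone h /\ semidiff f u h = h] = [set 0] <->
      (cone_spectral_radius (@nonpos_cone R d) (semidiff f u) < 1%:E)%E)).
Proof.
split; first exact: locally_minimal_fixpointP.
move=> /(piecewise_affine_expansion u)[g [gc gh fg]].
rewrite (semidiff_expansion gc gh fg); split.
  exact: smallest_fixpoint_expansionP.
apply: fixpoint_cone_spectral_radiusP => //; exact: expansion_norm_le fg.
Qed.
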